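(* Let $f(z)=\sum_{k=0}^\infty q_k z^k$ be any offspring generating function with $f'(1)=m$, where $1<m<\infty$, and $f''(1)=\infty$. Then there is a sequence of positive numbers $(p_n)_{n\ge 1}$ with $p_n\le 1$ for all $n$ such that both of the following hold: (i) $\displaystyle \sum_{n=1}^\infty \prod_{k=1}^n (m\cdot p_k)^{-1}<\infty$; and (ii) the branching process in a varying environment with offspring generating functions $f_n(z)=f(1-p_n+p_n z)$, $n\ge 1$, dies out almost surely.
   Context: An offspring generating function is a power series $f(z)=\sum_{k\ge 0} q_k z^k$ with $q_k\ge 0$ and $\sum_k q_k=1$. Write $f'(1)=\sum_k k q_k$ and $f''(1)=\sum_k k(k-1)q_k\in[0,\infty]$; thus $f''(1)=\infty$ means that the offspring distribution has infinite second moment. A branching process in a varying environment (BPVE) is defined by a sequence of offspring generating functions $f_n(z)=\sum_{k\ge 0} q_{n,k}z^k$, $n\ge 1$, as follows. Generation $0$ consists of one individual (the root), $Z_0=1$. The root has a random number $Z_1$ of children with $\mathbf{P}(Z_1=k)=q_{1,k}$. In general, given generations $0,\dots,n$ with $Z_n$ individuals in generation $n$, the numbers of children of these $Z_n$ individuals are i.i.d., each equal to $k$ with probability $q_{n+1,k}$, and $Z_{n+1}$ is the total number of these children. The process dies out almost surely if $\mathbf{P}(Z_n\to 0)=1$, i.e. almost surely $Z_n=0$ for some $n$. *)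

(* Defs.v *)
From HB Require Import structures.
From mathcomp Require Import all_boot all_order all_algebra.
From mathcomp Require Import all_classical all_reals all_analysis.

Set Implicit Arguments.
Unset Strict Implicit.
Unset Printing Implicit Defensive.

Import Order.TTheory GRing.Theory Num.Theory.
Import numFieldNormedType.Exports.

Local Open Scope classical_set_scope.
Local Open Scope ring_scope.

Definition offspring_law (R : realType) (q : nat -> R) : Prop :=
  (forall k, 0 <= q k) /\ (\sum_(0 <= k <oo) (q k)%:E = 1)%E.

(* Only the values of [f] on [0, 1], where the power series always converges,
   are constrained; they determine the coefficients [q]. *)
Definition offspring_gf (R : realType) (f : R -> R) (q : nat -> R) : Prop :=
  offspring_law q /\
  (forall z : R, 0 <= z <= 1 ->
     series (fun k => q k * z ^+ k) @ \oo --> f z).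

(* [f'(1)] and [f''(1)], computed in the extended reals from the coefficients
   of [f]. *)
Definition gf_deriv1 (R : realType) (q : nat -> R) : \bar R :=
  (\sum_(0 <= k <oo) (k%:R * q k)%:E)%E.

Definition gf_deriv2 (R : realType) (q : nat -> R) : \bar R :=
  (\sum_(0 <= k <oo) ((k * k.-1)%N%:R * q k)%:E)%E.

(* [xi n i w] is the number of children of the [i]-th individual of generation
   [n]; only the indices [i < gen_size xi n w] refer to actual individuals. *)
Fixpoint gen_size (T : Type) (xi : nat -> nat -> T -> nat) (n : nat) (w : T)
    : nat :=
  if n is n'.+1 then (\sum_(i < gen_size xi n' w) xi n' i w)%N else 1%N.

(* Given the sizes [z 0], ..., [z n] of generations 0, ..., n, the numbers of
   children of the [z n] individuals of generation [n] are i.i.d. with law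
   [q n.+1].  The conditioning is written multiplicatively, so that no condition
   is imposed given a null event. The value [q 0] is not used. *)
Definition bpve (R : realType) (q : nat -> nat -> R)
    (d : measure_display) (T : measurableType d) (P : probability T R)
    (xi : nat -> nat -> {RV P >-> nat}) : Prop :=
  forall (n : nat) (z k : nat -> nat),
    let history :=
      [set w | forall j, (j <= n)%N -> gen_size xi j w = z j] in
    P (history `&` [set w | forall i, (i < z n)%N -> xi n i w = k i]) =
    (P history * (\prod_(i < z n) q n.+1 (k i))%:E)%E.

(* Extinction depends only on the law of the generation sizes, which [q]
   determines: hence the quantification over all realisations of the process.
   The limit is for the discrete topology of [nat]. *)
Definition dies_out_as (R : realType) (q : nat -> nat -> R) : Prop :=
  forall (d : measure_display) (T : measurableType d) (P : probability T R)
    (xi : nat -> nat -> {RV P >-> nat}),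
  bpve q xi ->
  P [set w | gen_size xi n w @[n --> \oo] --> 0%N] = 1%E.

(* Main.v *)
Require Import Defs.
From mathcomp Require Import all_boot all_order all_algebra.
From mathcomp Require Import ring lra zify.
From mathcomp Require Import all_classical all_reals all_analysis.
Set Implicit Arguments.
Unset Strict Implicit.
Unset Printing Implicit Defensive.
Import Order.TTheory GRing.Theory Num.Theory.
Import numFieldNormedType.Exports.
Local Open Scope classical_set_scope.
Local Open Scope ring_scope.

(** Why the theorem holds.

    Write g(x) = 1 - f(1 - x), so that x |-> g(p x) is the survival map of the
    offspring law thinned by p: if each individual of the next generation
    survives with probability x, an individual of the present one survives with
    probability g(p x).  The probability of reaching generation n is then
    g(p_1 g(p_2 ... g(p_n))), and since g(x) <= m x it is at most
    A u, where A is the mean size m p_1 ... m p_k of generation k and u is the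
    probability that an individual of generation k has descendants in
    generation n.

    All the parameters are taken in {1, 1/m}.  A stage with p = 1 multiplies the
    mean by m, and a stage with p = 1/m is critical and leaves the mean alone.
    The infinite second moment enters through a long critical block:
    g(x) <= m x - K x^2 near 0 for every K, so the probability v_L of surviving L
    critical stages, which satisfies v_{L+1} = g(v_L / m), is o(1/L)
    ([critical_survival]).  With a finite second moment it would be of order 1/L.

    Suppose now that the mean has been raised to A and insert about d A critical
    stages.  They add at most d to the series of the reciprocals of the means,
    while the survival probability drops to at most A v_L, which is o(1) as A
    grows, d being fixed.  Hence every finite word of parameters extends to one
    with an arbitrarily small survival probability at an arbitrarily small cost
    ([extend_word]); the stages with p = 1 used to raise A contribute only a
    geometric series, which [potential] pays for in advance.  Iterating with
    d = 2^-i gives an infinite sequence of parameters for which the series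
    converges and the survival probability tends to 0.

    For an arbitrary realisation of the process, extinction follows from the
    bound P(Z_N = 0) >= 1 - g(p_1 g(p_2 ... g(p_N))), which is proved by
    backward induction on the generation, conditionally on the sizes of the
    generations up to the present one ([extinct_ge]). *)

(** * The survival map of an offspring law near the origin *)

(** The next lemmas bound 1 - (1 - x)^k, the contribution of a family of k
    children to g(x): from above by its tangent k x, and with a quadratic
    correction.  The crude correction x^2 is available on the whole of [0, 1];
    the sharp one, of order k^2 x^2, only while k x <= 1. *)
Lemma onem_exp_le_linear (R : realFieldType) (x : R) (k : nat) :
  0 <= x <= 1 -> 1 - (1 - x) ^+ k <= k%:R * x.
Proof.
move=> /andP[x0 x1]; elim: k => [|k IH]; first by rewrite expr0 mul0r subrr.
have y0 : 0 <= (1 - x) ^+ k by rewrite exprn_ge0 ?subr_ge0.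
have y1 : (1 - x) ^+ k <= 1 by rewrite exprn_ile1 ?subr_ge0 //; lra.
by rewrite exprS -natr1; nra.
Qed.

Lemma onem_exp_le_square (R : realFieldType) (x : R) (k : nat) :
  0 <= x <= 1 -> (2 <= k)%N -> 1 - (1 - x) ^+ k <= k%:R * x - x ^+ 2.
Proof.
move=> /andP[x0 x1]; case: k => [|[|k]] // _; elim: k => [|k IH].
  by rewrite !expr2; lra.
have y0 : 0 <= (1 - x) ^+ k.+2 by rewrite exprn_ge0 ?subr_ge0.
have y1 : (1 - x) ^+ k.+2 <= 1 by rewrite exprn_ile1 ?subr_ge0 //; lra.
by rewrite exprS -[k.+3%:R]natr1; move: IH y0 y1; set y := _ ^+ k.+2; nra.
Qed.

Lemma exp_onem_le_half (R : realFieldType) (x : R) (k : nat) :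
  0 <= x -> k%:R * x <= 1 -> (1 - x) ^+ k <= 1 - k%:R * x / 2.
Proof.
move=> x0; elim: k => [|k IH] kx; first by rewrite expr0 mul0r; lra.
move: kx; rewrite -natr1 => kx; have k0 : 0 <= k%:R :> R by [].
have {}IH : (1 - x) ^+ k <= 1 - k%:R * x / 2 by apply: IH; nra.
have x1 : x <= 1 by nra.
by rewrite exprS; move: IH; set y := _ ^+ k; nra.
Qed.

(** The increment of the left-hand side from k to k + 1 is x (1 - x)^k, at most
    x - k x^2 / 2 by the previous bound; summing these increments gives
    k (k - 1) / 4 as the coefficient of x^2. *)
Lemma onem_exp_le_quadratic (R : realFieldType) (x : R) (k : nat) :
  0 <= x -> k%:R * x <= 1 ->
  1 - (1 - x) ^+ k <= k%:R * x - (k * k.-1)%N%:R / 4 * x ^+ 2.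
Proof.
move=> x0; elim: k => [|k IH] kx; first by rewrite expr0 !mul0r subrr subr0.
have k0 : 0 <= k%:R :> R by [].
have kx' : k%:R * x <= 1 by move: kx; rewrite -natr1; nra.
have := IH kx'; have := @exp_onem_le_half _ x k x0 kx'.
rewrite [(1 - x) ^+ _.+1]exprS /=; set y := _ ^+ k => h1 h2.
have -> : (k.+1 * k)%N%:R = (k * k.-1)%N%:R + 2 * k%:R :> R.
  by rewrite -natrM -natrD; congr (_%:R); case: (k) => [|n] /=; lia.
move: h2; set a := (k * k.-1)%N%:R; rewrite -[k.+1%:R]natr1 => h2; have := ler_wpM2l x0 h1; lra.
Qed.

Lemma nneseries_EFin_cvg (R : realType) (u : nat -> R) (l : R) :
  (forall k, 0 <= u k) ->
  (\sum_(0 <= k <oo) (u k)%:E = l%:E)%E <-> series u @ \oo --> l.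
Proof.
move=> u0.
have sE : (fun n => \sum_(0 <= k < n) (u k)%:E)%E = (fun n => (series u n)%:E).
  by apply/funext => n; rewrite sumEFin.
split=> [h|h].
  have : ((fun n => \sum_(0 <= k < n) (u k)%:E) @ \oo --> l%:E)%E.
    by rewrite -h; apply: is_cvg_nneseries => n _ _; rewrite lee_fin.
  by rewrite sE => /fine_cvgP[].
apply/cvg_lim => //; rewrite sE.
by apply: cvg_EFin => //; near=> n.
Unshelve. all: by end_near. Qed.

Lemma offspring_law_cvg (R : realType) (q : nat -> R) :
  offspring_law q -> series q @ \oo --> (1 : R).
Proof. by case=> q0; rewrite nneseries_EFin_cvg. Qed.

Lemma gf_deriv1_cvg (R : realType) (q : nat -> R) (m : R) :
  (forall k, 0 <= q k) -> gf_deriv1 q = m%:E ->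
  series (fun k => k%:R * q k) @ \oo --> m.
Proof. by move=> q0; rewrite /gf_deriv1 nneseries_EFin_cvg // => k; rewrite mulr_ge0. Qed.

Lemma gf_deriv2_unbounded (R : realType) (q : nat -> R) (K : R) :
  (forall k, 0 <= q k) -> gf_deriv2 q = +oo%E ->
  exists J : nat, K <= \sum_(0 <= k < J) (k * k.-1)%N%:R * q k.
Proof.
move=> q0 hq; apply: contrapT => /forallNP hK.
have : (gf_deriv2 q <= K%:E)%E; last by rewrite hq.
apply: lime_le; first by apply: is_cvg_nneseries => n _ _; rewrite lee_fin mulr_ge0.
near=> J; rewrite sumEFin lee_fin; apply/ltW; rewrite ltNge; apply/negP.
exact: hK.
Unshelve. all: by end_near. Qed.

(** Bounds on the contributions of single family sizes are summed against q.
    Keeping the corrections only for k < J makes room for a truncated second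
    factorial moment, the full one being infinite in the application. *)
Lemma onem_gf_le (R : realType) (f : R -> R) (q : nat -> R) (m x : R)
    (c : nat -> R) (J : nat) :
  offspring_gf f q -> gf_deriv1 q = m%:E -> 0 <= x <= 1 ->
  (forall k, 0 <= c k) ->
  (forall k, 1 - (1 - x) ^+ k <= k%:R * x - c k) ->
  1 - f (1 - x) <= m * x - \sum_(0 <= k < J) q k * c k.
Proof.
move=> [hq hf] hm x01 c0 hc; have q0 := hq.1; set C := \sum_(_ <= _ < _) _.
have hf1 : series (fun k => q k * (1 - x) ^+ k) @ \oo --> f (1 - x).
  by apply: hf; lra.
have h1 : series q n - series (fun k => q k * (1 - x) ^+ k) n @[n --> \oo]
    --> 1 - f (1 - x) by apply: cvgB => //; exact: offspring_law_cvg.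
have h2 : series (fun k => k%:R * q k) n * x - C @[n --> \oo] --> m * x - C.
  by apply: cvgB; [apply: cvgMl; exact: gf_deriv1_cvg|exact: cvg_cst].
apply: (ler_cvg_to h1 h2); near=> N.
have JN : (J <= N)%N by near: N; exact: nbhs_infty_ge.
rewrite /series /= -sumrB mulr_suml.
apply: (@le_trans _ _ (\sum_(0 <= k < N) (k%:R * q k * x - q k * c k))).
  by apply: ler_sum => k _; have := hc k; have := q0 k; nra.
rewrite sumrB lerD2l lerN2 /C [leRHS](@big_cat_nat _ _ _ J) //= lerDl.
by apply: sumr_ge0 => k _; rewrite mulr_ge0.
Unshelve. all: by end_near. Qed.

Lemma offspring_gf_itv (R : realType) (f : R -> R) (q : nat -> R) (z : R) :
  offspring_gf f q -> 0 <= z <= 1 -> 0 <= f z <= 1.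
Proof.
move=> [hq hf] z01; have q0 := hq.1; have fz := hf z z01.
have [z0 z1] := andP z01.
have h1 := offspring_law_cvg hq.
apply/andP; split.
  apply: (ler_cvg_to (cvg_cst 0) fz); near=> N.
  by apply: sumr_ge0 => k _; rewrite mulr_ge0 ?exprn_ge0.
apply: (ler_cvg_to fz h1); near=> N.
by apply: ler_sum => k _; rewrite ler_piMr// exprn_ile1.
Unshelve. all: by end_near. Qed.

Lemma onem_gf_le_mean (R : realType) (f : R -> R) (q : nat -> R) (m x : R) :
  offspring_gf f q -> gf_deriv1 q = m%:E -> 0 <= x <= 1 ->
  1 - f (1 - x) <= m * x.
Proof.
move=> hf hm x01.
have := @onem_gf_le _ f q m x (fun=> 0) 0 hf hm x01.
rewrite big_geq // subr0; apply=> // k.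
by rewrite subr0 onem_exp_le_linear.
Qed.

(** Since the second factorial moment is nonzero, some family size k >= 2 has
    positive probability, and it alone gives the correction. *)
Lemma onem_gf_le_square (R : realType) (f : R -> R) (q : nat -> R) (m : R) :
  offspring_gf f q -> gf_deriv1 q = m%:E -> gf_deriv2 q = +oo%E ->
  exists2 c : R, 0 < c &
    forall x, 0 <= x <= 1 -> 1 - f (1 - x) <= m * x - c * x ^+ 2.
Proof.
move=> hf hm hf2; have q0 := hf.1.1.
have [J hJ] := @gf_deriv2_unbounded _ q 1 q0 hf2.
have [k k2 qk] : exists2 k, (2 <= k)%N & 0 < q k.
  apply: contrapT => /forall2NP h.
  suff : 1 <= 0 :> R by rewrite ler10.
  apply: (le_trans hJ); rewrite big1 // => -[|[|k]] _; rewrite ?mul0r //.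
  have [//|/negP] := h k.+2; rewrite -leNgt => qk.
  by rewrite (_ : q _ = 0) ?mulr0//; apply/eqP; rewrite eq_le qk q0.
exists (q k) => // x x01.
have := @onem_gf_le _ f q m x (fun j => if (2 <= j)%N then x ^+ 2 else 0) k.+1 hf hm x01.
have h j : 0 <= if (2 <= j)%N then x ^+ 2 else 0 by case: ifP; rewrite ?sqr_ge0.
move=> /(_ h) H; apply: (le_trans (H _)).
  move=> j; case: ifP => j2; first exact: onem_exp_le_square.
  by rewrite subr0 onem_exp_le_linear.
rewrite lerD2l lerN2 big_nat_recr //= k2 lerDr.
by apply: sumr_ge0 => j _; rewrite mulr_ge0.
Qed.

(** This is where the infinite second moment is used: the truncated second
    factorial moment up to J exceeds 4 K for J large, and 1/(J + 1) is small
    enough for the sharp correction to apply to all k < J. *)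
Lemma onem_gf_le_quadratic (R : realType) (f : R -> R) (q : nat -> R) (m K : R) :
  offspring_gf f q -> gf_deriv1 q = m%:E -> gf_deriv2 q = +oo%E ->
  exists2 x0 : R, 0 < x0 <= 1 &
    forall x, 0 <= x <= x0 -> 1 - f (1 - x) <= m * x - K * x ^+ 2.
Proof.
move=> hf hm hf2; have q0 := hf.1.1.
have [J hJ] := @gf_deriv2_unbounded _ q (4 * K) q0 hf2.
have J1 : 1 <= J.+1%:R :> R by rewrite ler1n.
exists J.+1%:R^-1; first by rewrite invr_gt0 ltr0n /= invf_le1 // ltr0n.
move=> x /andP[x0]; rewrite -[leRHS]div1r ler_pdivlMr // => xJ.
have x01 : 0 <= x <= 1 by apply/andP; split => //; nra.
pose c k : R := if (k < J)%N then (k * k.-1)%N%:R / 4 * x ^+ 2 else 0.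
have c0 k : 0 <= c k.
  by rewrite /c; case: ifP => // _; rewrite mulr_ge0 ?sqr_ge0 ?divr_ge0.
apply: (le_trans (@onem_gf_le _ f q m x c J hf hm x01 c0 _)).
  move=> k; rewrite /c; case: ifP => kJ.
    apply: onem_exp_le_quadratic => //.
    have : k%:R <= J.+1%:R :> R by rewrite ler_nat; lia.
    by move=> ?; nra.
  by rewrite subr0 onem_exp_le_linear.
rewrite lerD2l lerN2.
have -> : \sum_(0 <= k < J) q k * c k =
          (\sum_(0 <= k < J) (k * k.-1)%N%:R * q k) / 4 * x ^+ 2.
  rewrite mulrAC -mulrA mulr_suml; apply: eq_big_nat => k /andP[_ kJ].
  by rewrite /c kJ; ring.
by rewrite ler_wpM2r ?sqr_ge0//; lra.
Qed.

(** * Words of thinning parameters *)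

Definition valid_word (R : realType) (s : seq R) := all (fun p => 0 < p <= 1) s.

(** The entries of s are the thinning parameters of successive generations,
    the first one acting on the children of the root; the value is the
    probability that the process reaches generation [size s]. *)
Definition survival (R : realType) (f : R -> R) (s : seq R) : R :=
  foldr (fun p x => 1 - f (1 - p * x)) 1 s.

(** Mean size of generation [size s]. *)
Definition growth (R : realType) (m : R) (s : seq R) : R := \prod_(p <- s) (m * p).

(** Partial sum of the series of the reciprocals of the mean generation sizes,
    in Horner form; [cost_sum] gives the usual form. *)
Fixpoint cost (R : realType) (m : R) (s : seq R) : R :=
  if s is p :: s' then (m * p)^-1 * (1 + cost m s') else 0.

Lemma survival_itv (R : realType) (f : R -> R) (q : nat -> R) (s : seq R) :
  offspring_gf f q -> valid_word s -> 0 <= survival f s <= 1.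
Proof.
move=> hf; elim: s => [_|p s IH]; rewrite /valid_word /=; first by rewrite ler01 lexx.
move=> /andP[/andP[p0 p1] /IH/andP[x0 x1]].
have := @offspring_gf_itv _ f q (1 - p * survival f s) hf.
by move=> h; rewrite subr_ge0 lerBlDr lerDl andbC; apply: h; nra.
Qed.

Lemma growth_gt0 (R : realType) (m : R) (s : seq R) :
  0 < m -> valid_word s -> 0 < growth m s.
Proof.
move=> m0; rewrite /growth; elim: s => [|p s IH]; first by rewrite big_nil.
by rewrite big_cons /valid_word /= => /andP[/andP[p0 _] /IH h]; rewrite !mulr_gt0.
Qed.

(** The union bound over the individuals living at the end of s. *)
Lemma survival_cat_le (R : realType) (f : R -> R) (q : nat -> R) (m : R)
    (s t : seq R) :
  offspring_gf f q -> gf_deriv1 q = m%:E -> 0 <= m -> valid_word s -> valid_word t ->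
  survival f (s ++ t) <= growth m s * survival f t.
Proof.
move=> hf hm m0 + vt; rewrite /growth.
elim: s => [|p s IH]; first by rewrite big_nil mul1r.
rewrite big_cons /= => vps; have /andP[/andP[p0 p1] vs] := vps.
have vst : valid_word (s ++ t) by rewrite /valid_word all_cat; apply/andP; split.
have /andP[y0 y1] := @survival_itv _ _ _ _ hf vst.
apply: le_trans (@onem_gf_le_mean _ _ _ _ _ hf hm _) _; first by apply/andP; nra.
by rewrite -!mulrA ler_wpM2l // ler_wpM2l ?IH// ltW.
Qed.

Lemma growth_cat (R : realType) (m : R) (s t : seq R) :
  growth m (s ++ t) = growth m s * growth m t.
Proof. by rewrite /growth big_cat. Qed.

Lemma growth_nseq (R : realType) (m p : R) (k : nat) :
  growth m (nseq k p) = (m * p) ^+ k.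
Proof. by rewrite /growth big_nseq -Monoid.iteropE. Qed.

Lemma cost_cat (R : realType) (m : R) (s t : seq R) :
  cost m (s ++ t) = cost m s + cost m t / growth m s.
Proof.
rewrite /growth; elim: s => [|p s IH] /=; first by rewrite big_nil add0r divr1.
by rewrite big_cons IH addrA mulrDr [in RHS](invfM (m * p)) [in RHS]mulrCA.
Qed.

Lemma cost_ge0 (R : realType) (m : R) (s : seq R) :
  0 < m -> valid_word s -> 0 <= cost m s.
Proof.
move=> m0; elim: s => //= p s IH /andP[/andP[p0 _] /IH h].
by rewrite mulr_ge0 ?addr_ge0 // invr_ge0 mulr_ge0 // ltW.
Qed.

(** The stage from generation k - 1 to generation k has its parameter at index
    k - 1 of the word, hence the predecessor. *)
Lemma cost_sum (R : realType) (m : R) (s : seq R) (N : nat) :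
  (N <= size s)%N ->
  \sum_(1 <= n < N.+1) \prod_(1 <= k < n.+1) (m * nth 1 s k.-1)^-1 = cost m (take N s).
Proof.
elim: s N => [|p s IH] [|N] //= NS; try by rewrite big_geq.
rewrite -IH // [LHS]big_nat_recl // big_nat1 /= mulrDr mulr1; congr (_ + _).
rewrite big_distrr /=; apply: eq_big_nat => n _.
rewrite big_nat_recl //; congr (_ * _).
by apply: eq_big_nat => -[].
Qed.

(** The second term is the sum of the geometric series that the cost would still
    collect if all later parameters were 1; hence appending ones does not
    change the potential ([potential_grow]), and only critical stages have to be
    accounted for. *)
Definition potential (R : realType) (m : R) (s : seq R) : R :=
  cost m s + ((m - 1) * growth m s)^-1.

Lemma cost_take_le (R : realType) (m : R) (s : seq R) (N : nat) :
  1 < m -> valid_word s -> cost m (take N s) <= potential m s.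
Proof.
move=> m1 vs; have m0 : 0 < m by apply: lt_trans m1.
have vtd : valid_word (take N s) && valid_word (drop N s) by rewrite -all_cat cat_take_drop.
have [vt vd] := andP vtd.
rewrite /potential -{2}(cat_take_drop N s) cost_cat -addrA lerDl addr_ge0 //.
  by rewrite divr_ge0 ?cost_ge0 // ltW // growth_gt0.
by rewrite invr_ge0 mulr_ge0 ?subr_ge0 ?(ltW m1) // ltW // growth_gt0.
Qed.

Lemma potential_grow (R : realType) (m : R) (s : seq R) (k : nat) :
  1 < m -> valid_word s -> potential m (s ++ nseq k 1) = potential m s.
Proof.
move=> m1 vs; have m0 : 0 < m by lra.
elim: k => [|k IH]; first by rewrite cats0.
rewrite -IH -addn1 nseqD catA /potential !cost_cat !growth_cat /= /growth.
rewrite !big_seq1 mulr1.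
have := growth_gt0 m0 vs; have : 0 < growth m (nseq k 1).
  by rewrite growth_nseq exprn_gt0 // mulr1.
rewrite /growth; move=> a0 b0; field.
by rewrite !gt_eqF //; lra.
Qed.

Lemma cost_critical (R : realType) (m : R) (L : nat) :
  0 < m -> cost m (nseq L m^-1) = L%:R.
Proof.
move=> m0; elim: L => //= L ->.
by rewrite divff ?gt_eqF // invr1 mul1r -natr1 addrC.
Qed.

Lemma growth_critical (R : realType) (m : R) (L : nat) :
  0 < m -> growth m (nseq L m^-1) = 1.
Proof. by move=> m0; rewrite growth_nseq divff ?gt_eqF // expr1n. Qed.

(** * Long critical blocks *)

(** The discrete form of v' = - c v^2, whose solutions satisfy 1/v >= c t.  It is
    stated as a product because v may vanish. *)
Lemma quadratic_decrease (R : realFieldType) (v : nat -> R) (c : R) (n : nat) :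
  0 <= c -> (forall i, 0 <= v i) ->
  (forall i, v i.+1 <= v i - c * v i ^+ 2) ->
  v n * (c * n%:R) <= 1.
Proof.
move=> c0 v0 step; elim: n => [|n IH]; first by rewrite !mulr0.
have b0 : 0 <= c * n%:R by rewrite mulr_ge0.
rewrite -natr1 mulrDr mulr1; move: IH b0; set b := c * n%:R => IH b0.
apply: (@le_trans _ _ ((v n - c * v n ^+ 2) * (b + c))).
  by rewrite ler_wpM2r ?step// addr_ge0.
have := v0 n; move: IH; set y := v n => IH y0.
have -> : (y - c * y ^+ 2) * (b + c) =
  1 - ((1 - y * b) * (1 - c * y) + (c * y) ^+ 2) by ring.
have : 0 <= y * b by rewrite mulr_ge0.
have : 0 <= c * y by rewrite mulr_ge0.
move: IH; set t := y * b; set s := c * y => t1 s0 t0; nra.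
Qed.

(** The correction that is uniform on [0, 1] first brings the survival
    probability below any threshold x0; from then on the quadratic correction
    with constant K = 2 m^2 / eta acts, and yields decay with the constant
    2 / eta in place of a fixed one.  Waiting for twice the time L1 needed to get
    below x0 makes the lost initial stretch cost at most a factor 2. *)
Lemma critical_survival (R : realType) (f : R -> R) (q : nat -> R) (m eta : R) :
  offspring_gf f q -> gf_deriv1 q = m%:E -> 1 < m -> gf_deriv2 q = +oo%E ->
  0 < eta ->
  exists L0 : nat, forall L, (L0 <= L)%N ->
    survival f (nseq L m^-1) * L%:R <= eta.
Proof.
move=> hf hm m1 hf2 eta0.
have m0 : 0 < m by apply: lt_trans m1.
have mV : 0 < m^-1 <= 1 by rewrite invr_gt0 m0 invf_le1//; lra.
pose v L := survival f (nseq L m^-1).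
have v01 L : 0 <= v L <= 1.
  by apply: survival_itv hf _; rewrite /valid_word all_nseq mV orbT.
have v0 L : 0 <= v L by case/andP: (v01 L).
have vm L : 0 <= m^-1 * v L <= v L.
  by have := v01 L; move: mV; set a := m^-1; nra.
have vS L c : 1 - f (1 - m^-1 * v L) <= m * (m^-1 * v L) - c * (m^-1 * v L) ^+ 2 ->
    v L.+1 <= v L - (c / m ^+ 2) * v L ^+ 2.
  rewrite [v L.+1]/v /= -/(v L) => h; apply: (le_trans h).
  by rewrite le_eqVlt; apply/orP; left; apply/eqP; field; rewrite !gt_eqF.
have [c c0 hc] := onem_gf_le_square hf hm hf2.
have [x0 x01 hx0] := @onem_gf_le_quadratic _ f q m (2 * m ^+ 2 / eta) hf hm hf2.
clear hm hf2.
have c'0 : 0 < c / m ^+ 2 by rewrite divr_gt0 // exprn_gt0.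
have small L : v L * (c / m ^+ 2 * L%:R) <= 1.
  apply: quadratic_decrease => //; first exact: ltW.
  by move=> i; apply: vS; apply: hc; have := vm i; have := v01 i; lra.
pose L1 := (Num.truncn ((c / m ^+ 2 * x0)^-1)).+1.
have hL1 L : (L1 <= L)%N -> v L <= x0.
  move=> L1L; have : (c / m ^+ 2 * x0)^-1 < L%:R.
    by rewrite (lt_le_trans (truncnS_gt _))// ler_nat.
  have [x0p _] := andP x01.
  have cx : 0 < c / m ^+ 2 * x0 by rewrite mulr_gt0.
  rewrite -[ltLHS]div1r ltr_pdivrMr //.
  have := small L; have := v0 L; move: c'0; set a := c / m ^+ 2.
  set b := L%:R => a0 y0 h1 h2; rewrite leNgt; apply/negP => xy.
  have : 0 <= b by [].
  by move=> b0; nra.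
have decay i : v (L1 + i)%N * (2 / eta * i%:R) <= 1.
  apply: (@quadratic_decrease _ (fun i => v (L1 + i)%N)) => //.
    by rewrite divr_ge0// ltW.
  move=> j; rewrite addnS.
  have -> : 2 / eta = 2 * m ^+ 2 / eta / m ^+ 2 by field; rewrite !gt_eqF.
  apply: vS; apply: hx0.
  by have := hL1 (L1 + j)%N (leq_addr _ _); have := vm (L1 + j)%N; lra.
exists (2 * L1)%N => L hL.
have := decay (L - L1)%N; rewrite subnKC; last by lia.
rewrite -[survival _ _]/(v L); have := v0 L.
have : L%:R <= 2 * (L - L1)%N%:R :> R by rewrite -natrM ler_nat; lia.
set b := (L - L1)%N%:R; set y := v L => hb y0.
have -> : y * (2 / eta * b) = (2 * y * b) / eta by ring.
by rewrite ler_pdivrMr // mul1r => h; nra.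
Qed.

Lemma exp_unbounded (R : realType) (m M : R) :
  1 < m -> exists2 k : nat, (0 < k)%N & M <= m ^+ k.
Proof.
move=> m1; have bern k : 1 + k%:R * (m - 1) <= m ^+ k.
  elim: k => [|k IH]; first by rewrite mul0r addr0.
  have h1 : m * (1 + k%:R * (m - 1)) <= m ^+ k.+1 by rewrite exprS ler_wpM2l//; lra.
  have h2 : 0 <= k%:R * (m - 1) ^+ 2 by rewrite mulr_ge0 ?sqr_ge0.
  by apply: le_trans h1; rewrite -natr1; move: h2; rewrite expr2; lra.
exists (Num.truncn (M / (m - 1))).+1 => //.
apply: le_trans (bern _); have := truncnS_gt (M / (m - 1)).
by rewrite ltr_pdivrMr; lra.
Qed.

(** Enough ones are appended to raise the mean to a large B, then L critical
    stages, where L is the integer part of d B.  These add L / B <= d to the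
    cost, and the survival probability is at most B v_L, of order L v_L / d,
    which is small by [critical_survival]. *)
Lemma extend_word (R : realType) (f : R -> R) (q : nat -> R) (m d : R)
    (s : seq R) :
  offspring_gf f q -> gf_deriv1 q = m%:E -> 1 < m -> gf_deriv2 q = +oo%E ->
  0 < d -> valid_word s ->
  exists w : seq R, [/\ valid_word w, (0 < size w)%N,
    potential m (s ++ w) <= potential m s + d & survival f (s ++ w) <= d].
Proof.
move=> hf hm m1 hf2 d0 vs.
have m0 : 0 < m by apply: lt_trans m1.
have mV : 0 < m^-1 <= 1 by rewrite invr_gt0 m0 invf_le1// ltW.
have d20 : 0 < d ^+ 2 / 2 by rewrite divr_gt0 // exprn_gt0.
have [L0 hL0] := @critical_survival _ f q m (d ^+ 2 / 2) hf hm m1 hf2 d20.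
have G0 := growth_gt0 m0 vs.
have [k k0 hk] := exp_unbounded (L0.+1%:R / d / growth m s) m1.
pose B := growth m s * m ^+ k.
have hB : L0.+1%:R <= d * B.
  by move: hk; rewrite !ler_pdivrMr // /B => h; rewrite mulrC [growth m s * _]mulrC.
have B0 : 0 < B by rewrite mulr_gt0 ?exprn_gt0.
pose L := Num.truncn (d * B).
have /andP[LB BL] : L%:R <= d * B < L.+1%:R by apply: truncn_itv; rewrite mulr_ge0 // ltW.
have L0L : (L0 < L)%N by rewrite /L truncn_ge_nat // mulr_ge0 // ltW.
have v1 : valid_word (nseq k (1 : R)) by rewrite /valid_word all_nseq ltr01 lexx orbT.
have vm : valid_word (nseq L m^-1) by rewrite /valid_word all_nseq mV orbT.
have vs1 : valid_word (s ++ nseq k 1) by rewrite /valid_word all_cat; apply/andP; split.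
have gB : growth m (s ++ nseq k 1) = B by rewrite growth_cat growth_nseq mulr1.
exists (nseq k 1 ++ nseq L m^-1); split.
- by rewrite /valid_word all_cat; apply/andP; split.
- by rewrite size_cat size_nseq addn_gt0 k0.
- rewrite -(potential_grow k m1 vs) catA /potential.
  rewrite (cost_cat _ (s ++ _)) (growth_cat _ (s ++ _)).
  rewrite growth_critical // mulr1 cost_critical // gB addrAC lerD2l.
  by rewrite ler_pdivrMr.
rewrite catA; apply: (le_trans (survival_cat_le hf hm (ltW m0) vs1 vm)).
rewrite gB; have := hL0 L (ltnW L0L).
have /andP[] := survival_itv hf vm.
set v := survival _ _ => x0 _.
clearbody L; clear hm hf2; have L1 : 1 <= L%:R :> R by rewrite ler1n (leq_ltn_trans _ L0L).
move: BL; rewrite -natr1 => BL h.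
have h1 : d * B <= 2 * L%:R by lra.
have h2 : v * (d * B) <= v * (2 * L%:R) by rewrite ler_wpM2l.
have : d * (B * v) <= d * d by move: h; rewrite expr2; lra.
by rewrite ler_pM2l.
Qed.

(** Dependent choice on [extend_word], with tolerance 2^-i at step i.  The
    potential is then bounded by its initial value plus the sum 2 of the
    tolerances; the induction keeps track of the unspent part 2 * 2^-i. *)
Lemma good_word_chain (R : realType) (f : R -> R) (q : nat -> R) (m : R) :
  offspring_gf f q -> gf_deriv1 q = m%:E -> 1 < m -> gf_deriv2 q = +oo%E ->
  exists s : nat -> seq R, forall i,
    [/\ valid_word (s i), (i <= size (s i))%N, prefix (s i) (s i.+1),
        potential m (s i) <= potential m [::] + 2 &
        survival f (s i.+1) <= 2^-1 ^+ i].
Proof.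
move=> hf hm m1 hf2.
have /choice[w hw] : forall si : seq R * nat, exists w : seq R, valid_word si.1 ->
  [/\ valid_word w, (0 < size w)%N,
    potential m (si.1 ++ w) <= potential m si.1 + 2^-1 ^+ si.2
    & survival f (si.1 ++ w) <= 2^-1 ^+ si.2].
  move=> [s i] /=; have [vs|nvs] := boolP (valid_word s); last by exists [::].
  have d0 : 0 < 2^-1 ^+ i :> R by rewrite exprn_gt0 // invr_gt0.
  by have [w hw] := extend_word hf hm m1 hf2 d0 vs; exists w.
clear hm hf2.
pose s := fix s i := if i is j.+1 then s j ++ w (s j, j) else [::].
have vs i : valid_word (s i).
  elim: i => //= i IH; rewrite /valid_word all_cat; apply/andP; split => //.
  by have [] := hw (s i, i) IH.
have ss i : (i <= size (s i))%N.
  elim: i => //= i IH; rewrite size_cat.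
  by have [_ + _ _] := hw (s i, i) (vs i); lia.
have ps i : potential m (s i) <= potential m [::] + 2 - 2 * 2^-1 ^+ i.
  elim: i => [|i IH]; first by rewrite expr0 mulr1 addrK.
  have [_ _ + _] := hw (s i, i) (vs i); rewrite /= exprS.
  by move=> h; rewrite mulrA divff ?mul1r; lra.
exists s => i; split => //.
- exact: prefix_prefix.
- apply: (le_trans (ps i)); rewrite gerBl.
  by apply: mulr_ge0 => //; apply: exprn_ge0; rewrite invr_ge0.
- by have [] := hw (s i, i) (vs i).
Qed.

(** * Thinned generating functions *)

Definition binomial_weight (R : realType) (p : R) (j k : nat) : R :=
  ((1 - p) ^+ (j - k) * p ^+ k) *+ 'C(j, k).

(** Coefficients of f(1 - p + p z): the law of the number of children when each
    of them is kept independently with probability p. *)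
Definition thinned (R : realType) (q : nat -> R) (p : R) (k : nat) : R :=
  fine (\sum_(0 <= j <oo) (q j * binomial_weight p j k)%:E)%E.

Lemma binomial_weight_ge0 (R : realType) (p : R) (j k : nat) :
  0 <= p <= 1 -> 0 <= binomial_weight p j k.
Proof.
by move=> /andP[p0 p1]; rewrite mulrn_wge0 // mulr_ge0 // exprn_ge0 // subr_ge0.
Qed.

Lemma binomial_weight_series (R : realType) (p z : R) (j : nat) :
  series (fun k => binomial_weight p j k * z ^+ k) @ \oo --> (1 - p + p * z) ^+ j.
Proof.
apply: cvg_near_cst; near=> n.
have jn : (j < n)%N by near: n; exact: nbhs_infty_gt.
rewrite /series /= (@big_cat_nat _ _ _ j.+1) //= [X in _ + X]big_nat_cond.
rewrite [X in _ + X]big1 ?addr0; last first.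
  by move=> k /andP[/andP[jk _] _]; rewrite /binomial_weight bin_small // mulr0n mul0r.
rewrite big_mkord exprDn; apply: eq_bigr => k _.
by rewrite /binomial_weight mulrnAl -mulrA exprMn.
Unshelve. all: by end_near. Qed.

(** The weights are probabilities, so the series is dominated by that of q and
    its sum is finite. *)
Lemma thinned_EFin (R : realType) (q : nat -> R) (p : R) (k : nat) :
  offspring_law q -> 0 <= p <= 1 ->
  (thinned q p k)%:E = (\sum_(0 <= j <oo) (q j * binomial_weight p j k)%:E)%E.
Proof.
move=> [q0 q1] p01; have w0 j := @binomial_weight_ge0 _ p j k p01.
have S0 : (0 <= \sum_(0 <= j <oo) (q j * binomial_weight p j k)%:E)%E.
  by apply: nneseries_ge0 => j _ _; rewrite lee_fin mulr_ge0.
rewrite fineK // ge0_fin_numE //; apply: le_lt_trans (ltry 1).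
rewrite -q1; apply: lee_nneseries => j _; first by rewrite lee_fin mulr_ge0.
rewrite lee_fin ler_piMr //.
have := @binomial_weight_series R p 1 j; rewrite mulr1 subrK expr1n => h.
apply: (ler_cvg_to (cvg_cst _) h); near=> n.
have kn : (k < n)%N by near: n; exact: nbhs_infty_gt.
rewrite /series /= big_mkord (bigD1 (Ordinal kn)) //= expr1n mulr1 lerDl.
by apply: sumr_ge0 => i _; rewrite expr1n mulr1 binomial_weight_ge0.
Unshelve. all: by end_near. Qed.

(** Expand (1 - p + p z)^j by the binomial theorem and exchange the two
    summations, all of whose terms are nonnegative. *)
Lemma thinned_gf (R : realType) (f : R -> R) (q : nat -> R) (p : R) :
  offspring_gf f q -> 0 <= p <= 1 ->
  offspring_gf (fun z => f (1 - p + p * z)) (thinned q p).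
Proof.
move=> [hq hf] p01; have [q0 q1] := hq; have [p0 p1] := andP p01.
have t0 k : 0 <= thinned q p k.
  rewrite -lee_fin thinned_EFin //; apply: nneseries_ge0 => j _ _.
  by rewrite lee_fin mulr_ge0 ?binomial_weight_ge0.
have gen z : 0 <= z <= 1 -> (\sum_(0 <= k <oo) (thinned q p k * z ^+ k)%:E =
     \sum_(0 <= j <oo) (q j * (1 - p + p * z) ^+ j)%:E)%E.
  move=> /andP[z0 z1].
  pose a k j := (q j * binomial_weight p j k * z ^+ k)%:E.
  have a0 k j : (0 <= a k j)%E.
    by rewrite lee_fin !mulr_ge0 ?exprn_ge0 ?binomial_weight_ge0.
  transitivity (\sum_(0 <= k <oo) \sum_(0 <= j <oo) a k j)%E.
    apply: eq_eseriesr => k _; rewrite EFinM thinned_EFin // muleC -nneseriesZl.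
      by apply: eq_eseriesr => j _; rewrite /a -EFinM mulrC.
    by move=> j _; rewrite lee_fin mulr_ge0 ?binomial_weight_ge0.
  rewrite nneseries_interchange //; apply: eq_eseriesr => j _.
  rewrite /a (eq_eseriesr (g := fun k => (q j)%:E * (binomial_weight p j k * z ^+ k)%:E)%E).
    rewrite nneseriesZl.
      rewrite EFinM; congr (_ * _)%E; apply/nneseries_EFin_cvg.
        by move=> k; rewrite mulr_ge0 ?exprn_ge0 ?binomial_weight_ge0.
      exact: binomial_weight_series.
    by move=> k _; rewrite lee_fin mulr_ge0 ?exprn_ge0 ?binomial_weight_ge0.
  by move=> k _; rewrite -EFinM mulrA.
split=> [|z z01].
  split=> //; rewrite -q1.
  have := gen 1; rewrite ler01 lexx => /(_ isT); rewrite mulr1 subrK.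
  under [in X in X = _]eq_eseriesr do rewrite expr1n mulr1.
  by under [in X in _ = X]eq_eseriesr do rewrite expr1n mulr1.
have [z0 z1] := andP z01.
apply/nneseries_EFin_cvg; first by move=> k; rewrite mulr_ge0 ?exprn_ge0.
have h01 : 0 <= 1 - p + p * z <= 1 by nra.
rewrite gen //; apply/nneseries_EFin_cvg; last exact: hf.
by move=> k; rewrite mulr_ge0 ?exprn_ge0 //; case/andP: h01.
Qed.

(** * Extinction from the conditional laws of the generations *)

Lemma sum_disjoint_le (R : realType) (d : measure_display) (T : measurableType d)
    (P : probability T R) (I : choiceType) (r : seq I) (A : I -> set T)
    (B : set T) :
  uniq r -> (forall i, measurable (A i)) -> measurable B -> trivIset setT A ->
  (forall i, i \in r -> A i `<=` B) ->
  \sum_(i <- r) fine (P (A i)) <= fine (P B).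
Proof.
move=> ur mA mB tA AB.
have fP C : measurable C -> P C \is a fin_num by move=> mC; exact: fin_num_measure.
rewrite -lee_fin -sumEFin fineK ?fP //.
rewrite (eq_bigr (fun i => P (A i))); last by move=> i _; rewrite fineK ?fP.
rewrite fsbig_seq //.
rewrite -measure_fin_bigcup; [|exact: finite_seq|exact: sub_trivIset tA|by []].
apply: le_measure; rewrite ?inE //.
  by apply: fin_bigcup_measurable => //; exact: finite_seq.
by move=> w [i /= ir Aw]; exact: AB Aw.
Qed.

Lemma measurable_gen_size (R : realType) (d : measure_display)
    (T : measurableType d) (P : probability T R)
    (xi : nat -> nat -> {RV P >-> nat})
    (n a : nat) :
  measurable [set w | gen_size xi n w = a].
Proof.
elim: n a => [|n IH] a /=.
  have [->|h] := eqVneq a 1%N; first by rewrite (_ : [set _ | _] = setT) //; apply/seteqP.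
  by rewrite (_ : [set _ | _] = set0) //; apply/seteqP; split=> // w /= e; rewrite e eqxx in h.
rewrite (_ : [set _ | _] = \bigcup_b ([set w | gen_size xi n w = b] `&`
    [set w | (\sum_(i < b) xi n i w)%N = a])); last first.
  apply/seteqP; split=> w /=; first by move=> h; exists (gen_size xi n w).
  by move=> [b _ [/= ->]].
apply: bigcupT_measurable => b; apply: measurableI; first exact: IH.
have mS : measurable_fun setT (fun w => (\sum_(i < b) xi n i w)%N).
  elim: b => [|b IHb].
    by under eq_fun do rewrite big_ord0; exact: measurable_cst.
  under eq_fun do rewrite big_ord_recr /=.
  by apply: measurable_realfun.measurable_fun_addn => //; exact: measurable_funPT.
by rewrite -[X in measurable X]setTI; apply: (mS measurableT [set a]).
Qed.

Definition history (T : Type) (xi : nat -> nat -> T -> nat) (n : nat)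
    (z : nat -> nat) : set T :=
  [set w | forall j, (j <= n)%N -> gen_size xi j w = z j].

Lemma measurable_history (R : realType) (d : measure_display)
    (T : measurableType d) (P : probability T R)
    (xi : nat -> nat -> {RV P >-> nat})
    (n : nat) (z : nat -> nat) :
  measurable (history xi n z).
Proof.
rewrite (_ : history _ _ _ =
  \bigcap_(j in [set j | (j <= n)%N]) [set w | gen_size xi j w = z j]) //.
by apply: bigcap_measurableType => j _; exact: measurable_gen_size.
Qed.

Lemma measurable_children (R : realType) (d : measure_display)
    (T : measurableType d) (P : probability T R)
    (xi : nat -> nat -> {RV P >-> nat})
    (n b : nat) (k : nat -> nat) :
  measurable [set w | forall i, (i < b)%N -> xi n i w = k i].
Proof.
rewrite (_ : [set _ | _] =
  \bigcap_(i in [set i | (i < b)%N]) [set w | xi n i w = k i]) //.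
apply: bigcap_measurableType => i _.
by rewrite -[X in measurable X]setTI; apply: (measurable_funPT (xi n i) measurableT [set k i]).
Qed.

Lemma history_next (T : Type) (xi : nat -> nat -> T -> nat) (n b : nat)
    (z : nat -> nat) :
  history xi n z `&` [set w | gen_size xi n.+1 w = b] =
  history xi n.+1 (fun j => if j == n.+1 then b else z j).
Proof.
apply/seteqP; split=> w.
  move=> [h e] j jn; case: eqP => [->//|/eqP ne].
  by apply: h; rewrite -ltnS ltn_neqAle ne.
move=> h; split; last by move: (h n.+1 (leqnn _)); rewrite eqxx.
by move=> j jn; have := h j (leqW jn); rewrite ltn_eqF.
Qed.

(** Conditionally on the sizes up to generation n, the next generation is a sum
    of z n independent variables of law q n.+1, so that its generating function
    at y is the (z n)-th power of that of q n.+1.  Truncating all family sizes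
    below M gives an inequality, but makes every sum finite: only finite
    additivity of the probability is needed, and M tends to infinity later. *)
Lemma next_generation_ge (R : realType) (q : nat -> nat -> R)
    (d : measure_display) (T : measurableType d) (P : probability T R)
    (xi : nat -> nat -> {RV P >-> nat}) (n M : nat) (z : nat -> nat) (y : R) :
  bpve q xi -> 0 <= y ->
  fine (P (history xi n z)) * (\sum_(k < M) q n.+1 k * y ^+ k) ^+ z n <=
  \sum_(b < (z n * M).+1)
    fine (P (history xi n z `&` [set w | gen_size xi n.+1 w = b])) * y ^+ b.
Proof.
move=> hb y0; set H := history xi n z.
have mH : measurable H by exact: measurable_history.
(* The conditional law is stated for family sizes indexed by nat, hence this
   extension of g by 0. *)
pose kk (g : {ffun 'I_(z n) -> 'I_M}) (j : nat) : nat :=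
  if insub j is Some i then g i else 0%N.
have kkE g (i : 'I_(z n)) : kk g i = g i by rewrite /kk valK.
pose C g := H `&` [set w | forall i, (i < z n)%N -> xi n i w = kk g i].
pose s (g : {ffun 'I_(z n) -> 'I_M}) := (\sum_i g i)%N.
have mC g : measurable (C g) by apply: measurableI => //; exact: measurable_children.
have CE g : fine (P (C g)) = fine (P H) * \prod_i q n.+1 (g i).
  have := hb n z (kk g); rewrite -/H -/(C g) /= => ->.
  rewrite fineM //; last exact: fin_num_measure.
  by congr (_ * _); apply: eq_bigr => i _; rewrite kkE.
have sM g : (s g < (z n * M).+1)%N.
  rewrite ltnS /s -[X in (_ <= X * _)%N]card_ord -sum_nat_const.
  by apply: leq_sum => i _; exact: ltnW.
have tC : trivIset setT C.
  move=> g g' _ _ [w [[_ h] [_ h']]]; apply/ffunP => i; apply: val_inj => /=.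
  by rewrite -!kkE -h // -h'.
have CS g w : C g w -> gen_size xi n.+1 w = s g.
  move=> [hH hk] /=; rewrite (hH n (leqnn n)) /s.
  by apply: eq_bigr => i _; rewrite hk // kkE.
have -> : (\sum_(k < M) q n.+1 k * y ^+ k) ^+ z n =
    \sum_(g : {ffun 'I_(z n) -> 'I_M}) \prod_i (q n.+1 (g i) * y ^+ g i).
  rewrite -[in LHS](card_ord (z n)) -prodr_const.
  exact: (bigA_distr_bigA (fun _ (k : 'I_M) => q n.+1 k * y ^+ k)).
rewrite mulr_sumr.
under eq_bigr => g _ do rewrite big_split /= -expr_sum mulrA -CE -/(s g).
(* Group the vectors of family sizes by their sum b: the corresponding events
   are disjoint parts of the event that generation n.+1 has size b. *)
rewrite (partition_big (fun g => inord (s g) : 'I_(z n * M).+1) xpredT) //=.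
apply: ler_sum => b _.
rewrite (eq_bigr (fun g => fine (P (C g)) * y ^+ b)); last first.
  by move=> g /eqP <-; rewrite inordK.
rewrite -mulr_suml ler_wpM2r ?exprn_ge0 // -big_filter.
apply: sum_disjoint_le => //.
- by rewrite filter_uniq // index_enum_uniq.
- by apply: measurableI => //; exact: (measurable_gen_size xi n.+1 b).
move=> g; rewrite mem_filter => /andP[/eqP gb _] w Cw; split; first by case: Cw.
by rewrite -gb inordK //; exact: CS.
Qed.

(** x n bounds from below the probability that the line of one individual of
    generation n is extinct by generation N.  The bound for z n individuals is
    proved given the whole history of generation sizes, because the law of the
    next generation is prescribed given that history; the induction goes
    backwards from n = N, and its last instance n = 0 has a trivial history. *)
Lemma extinct_ge (R : realType) (q : nat -> nat -> R)
    (d : measure_display) (T : measurableType d) (P : probability T R)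
    (xi : nat -> nat -> {RV P >-> nat}) (x F : nat -> R) (N : nat) :
  bpve q xi -> x N = 0 ->
  (forall n, (n <= N)%N -> 0 <= x n) ->
  (forall n, (n < N)%N -> x n <= F n) ->
  (forall n, (n < N)%N -> series (fun k => q n.+1 k * x n.+1 ^+ k) @ \oo --> F n) ->
  x 0%N <= fine (P [set w | gen_size xi N w = 0%N]).
Proof.
move=> hb xN x0 xF hF; set E := [set w | _].
have mE : measurable E by exact: measurable_gen_size.
have mH n z : measurable (history xi n z) by exact: measurable_history.
suff key k n z : (n + k)%N = N ->
    fine (P (history xi n z)) * x n ^+ z n <= fine (P (history xi n z `&` E)).
  have := key N 0%N (fun=> 1%N) erefl.
  rewrite (_ : history _ _ _ = setT); last first.
    by apply/seteqP; split=> // w _ j; rewrite leqn0 => /eqP ->.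
  by rewrite setTI probability_setT /= mul1r expr1.
elim: k n z => [|k IH] n z nk.
  (* For n = N both sides are the probability of the history if z N = 0, as
     0 ^ 0 = 1, and otherwise the left-hand side vanishes. *)
  rewrite addn0 in nk; rewrite nk xN expr0n; case: eqP => [zN|_].
    rewrite mulr1 (_ : _ `&` E = history xi N z) //.
    by apply/seteqP; split=> [w []//|w hw]; split=> //; rewrite /E /= hw.
  by rewrite mulr0 fine_ge0.
have nN : (n < N)%N by lia.
have lim : fine (P (history xi n z)) *
      series (fun k => q n.+1 k * x n.+1 ^+ k) M ^+ z n @[M --> \oo] -->
    fine (P (history xi n z)) * F n ^+ z n.
  apply: cvgMr.
  apply: (cvg_comp _ (fun y => y ^+ z n) (hF n nN)); exact: exprn_continuous.
apply: (@le_trans _ _ (fine (P (history xi n z)) * F n ^+ z n)).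
  by rewrite ler_wpM2l ?fine_ge0 // lerXn2r ?nnegrE ?x0 ?xF // ?(ltnW nN) // (le_trans (x0 n _)) ?xF // ltnW.
apply: (ler_cvg_to lim (cvg_cst _)); near=> M.
rewrite /series /= big_mkord.
apply: (le_trans (@next_generation_ge _ _ _ _ _ _ n M z _ hb (x0 _ nN))).
pose A b := history xi n.+1 (fun j => if j == n.+1 then b else z j).
apply: (@le_trans _ _ (\sum_(b < (z n * M).+1) fine (P (A b `&` E)))).
  apply: ler_sum => b _; rewrite history_next.
  have := IH n.+1 (fun j => if j == n.+1 then b : nat else z j).
  by rewrite eqxx; apply; rewrite addSnnS.
apply: sum_disjoint_le => //.
- exact: index_enum_uniq.
- by move=> b; apply: measurableI => //; exact: mH.
- exact: measurableI.
- move=> b b' _ _ [w [[h _] [h' _]]]; apply: val_inj => /=.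
  by have := h n.+1 (leqnn _); have := h' n.+1 (leqnn _); rewrite eqxx => ->.
move=> b _ w []; rewrite /A -history_next => -[h _] hE.
by split.
Unshelve. all: by end_near. Qed.

(** Convergence to 0 in a discrete space means being eventually 0, and 0 is
    absorbing. *)
Lemma extinction_cvgE (T : Type) (xi : nat -> nat -> T -> nat) :
  [set w | gen_size xi n w @[n --> \oo] --> 0%N] =
  \bigcup_N [set w | gen_size xi N w = 0%N].
Proof.
apply/seteqP; split=> w /=.
  by move=> /discrete_cvg[N _ hN]; exists N => //; apply: (hN N) => /=.
move=> [N _ /= hN]; apply: cvg_near_cst; exists N => // n /= /subnK <-.
by elim: (n - N)%N => //= k ->; rewrite big_ord0.
Qed.

(** Extinction by generation N, for whichever N the tolerance e calls for, is
    already part of the limit event. *)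
Lemma dies_out_of_extinct (R : realType) (d : measure_display)
    (T : measurableType d) (P : probability T R)
    (xi : nat -> nat -> {RV P >-> nat}) :
  (forall e : R, 0 < e ->
     exists N, 1 - e <= fine (P [set w | gen_size xi N w = 0%N])) ->
  P [set w | gen_size xi n w @[n --> \oo] --> 0%N] = 1%E.
Proof.
move=> h; rewrite extinction_cvgE; set U := \bigcup_N _.
have mE N : measurable [set w | gen_size xi N w = 0%N] by exact: measurable_gen_size.
have mU : measurable U by exact: bigcupT_measurable.
apply/eqP; rewrite eq_le probability_le1 //=.
apply/lee_addgt0Pr => e e0; have [N hN] := h e e0.
rewrite -leeBlDr // -EFinB; apply: (@le_trans _ _ (P [set w | gen_size xi N w = 0%N])).
  by rewrite -[leRHS]fineK ?lee_fin //; exact: fin_num_measure.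
by apply: le_measure; rewrite ?inE // => w hw; exists N.
Qed.

(** * Choice of the parameters *)

Theorem theorem1 (R : realType) (f : R -> R) (q : nat -> R) (m : R)
    (hf : offspring_gf f q)
    (hm : gf_deriv1 q = m%:E)
    (hm1 : 1 < m)
    (hf2 : gf_deriv2 q = +oo%E) :
  exists p : nat -> R,
    [/\ forall n, (1 <= n)%N -> 0 < p n <= 1,
        (\sum_(1 <= n <oo) (\prod_(1 <= k < n.+1) (m * p k)^-1)%:E < +oo)%E
      & exists qn : nat -> nat -> R,
          (forall n, (1 <= n)%N ->
             offspring_gf (fun z => f (1 - p n + p n * z)) (qn n)) /\
          dies_out_as qn ].
Proof.
have [s hs] := good_word_chain hf hm hm1 hf2.
have m0 : 0 < m by apply: lt_trans hm1.
have vs i : valid_word (s i) by case: (hs i).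
have ss i : (i <= size (s i))%N by case: (hs i).
have mono i j : (i <= j)%N -> prefix (s i) (s j).
  move=> /subnK <-; elim: (j - i)%N => [|k IH]; first exact: prefix_refl.
  by apply: prefix_trans IH _; case: (hs (k + i)%N).
(* The parameters are numbered from 1 and the entries of a word from 0.  The
   n-th word has at least n letters, so the default 1 is not reached for
   n >= 1. *)
pose p n := nth 1 (s n) n.-1.
have pE i k : (k < size (s i))%N -> nth 1 (s i) k = p k.+1.
  move=> ki; have kk := ss k.+1; rewrite /p /=.
  by case/orP: (leq_total i k.+1) => /mono/prefixP[t ->]; rewrite nth_cat ?ki ?kk.
have p01 n : (1 <= n)%N -> 0 < p n <= 1.
  by move=> n1; apply: (all_nthP 1 (vs n)); rewrite prednK.
have p01' n : (1 <= n)%N -> 0 <= p n <= 1.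
  by move=> /p01/andP[a b]; rewrite b ltW.
exists p; split=> //.
  apply: (@le_lt_trans _ _ (potential m [::] + 2)%:E); last exact: ltry.
  apply: lime_le.
    apply: is_cvg_nneseries => n _ _; rewrite lee_fin big_nat_cond prodr_ge0 //.
    move=> k /andP[/andP[k1 _] _]; rewrite invr_ge0 mulr_ge0 ?ltW //.
    by case/andP: (p01 k k1).
  near=> N; have N1 : (0 < N)%N by near: N; exact: nbhs_infty_gt.
  rewrite sumEFin lee_fin -(prednK N1); set n := N.-1.
  have [_ _ _ + _] := hs n; apply: le_trans.
  apply: le_trans (cost_take_le n hm1 (vs n)); rewrite -cost_sum //.
  rewrite le_eqVlt; apply/orP; left; apply/eqP.
  apply: eq_big_nat => i /andP[i1 iN]; apply: eq_big_nat => k /andP[k1 ki].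
  by rewrite pE prednK // (leq_trans _ (ss n)) // (@leq_trans i).
exists (fun n => thinned q (p n)); split=> [n n1|d T P xi hb].
  exact: thinned_gf hf (p01' n n1).
apply: dies_out_of_extinct => e e0.
have [i hi] : exists i : nat, 2^-1 ^+ i <= e.
  have [i _ hi] := @exp_unbounded R 2 e^-1 (ltr1n R 2).
  by exists i; rewrite exprVn invf_ple // posrE // exprn_gt0.
have [_ _ _ _ si] := hs i.
pose w := s i.+1; exists (size w).
(* Extinction probabilities of the stages of the word w: by definition of
   survival they satisfy x n = f (1 - p + p * x n.+1), where p is the entry of w
   at index n, so the inequality required by extinct_ge is an equality. *)
pose x n := 1 - survival f (drop n w).
have x01 n : 0 <= x n <= 1.
  have /(survival_itv hf)/andP[y0 y1] : valid_word (drop n w).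
    have : valid_word (take n w ++ drop n w) by rewrite cat_take_drop; exact: vs.
    by rewrite /valid_word all_cat => /andP[].
  by rewrite /x subr_ge0 y1 lerBlDr lerDl.
apply: (@le_trans _ _ (x 0%N)); first by rewrite /x drop0 lerD2l lerN2 (le_trans si).
apply: (extinct_ge (x := x) (F := x) hb) => //.
- by rewrite /x drop_size subrr.
- by move=> n _; case/andP: (x01 n).
move=> n nw; have [_ h] := thinned_gf hf (p01' n.+1 isT).
have -> : x n = f (1 - p n.+1 + p n.+1 * x n.+1); last exact: h.
rewrite {1}/x (drop_nth 1 nw) /= pE // opprB addrCA subrr addr0.
by congr f; rewrite /x; ring.
Unshelve. all: by end_near. Qed.
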